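(* For every $k\ge1$ and every $\Sigma^1_1(\mathrm{FOC}^k)$-definable generalized atom $A_Q$, for every sentence of $\mathrm{FO}^k(A_Q)$ there exists an equivalent sentence of $\Sigma^1_1(\mathrm{FOC}^k)$ (i.e., true in exactly the same models).
   Context: Team semantics (lax): structures have nonempty domains and relational vocabularies; an assignment is $s:D\to A$, $D$ a finite set of variables; a team $X$ is a set of assignments with common domain and codomain $A$; $\mathrm{rel}(X,(y_1,\dots,y_m))=\{(s(y_1),\dots,s(y_m)):s\in X\}$. Formulas in negation normal form (literals $R(\bar x),\neg R(\bar x),x_1=x_2,\neg x_1=x_2$, $\wedge,\vee,\exists,\forall$) plus generalized atoms; semantics: literal holds in $X$ iff all $s\in X$ satisfy it; $\wedge$ componentwise; $\psi\vee\vartheta$ holds in $X$ iff $X=Y\cup Z$, $Y\models\psi$, $Z\models\vartheta$; $\exists x\psi$ holds in $X$ iff $\psi$ holds in $\{s[a/x]:s\in X,a\in F(s)\}$ for some $F:X\to\mathcal P(A)\setminus\{\emptyset\}$; $\forall x\psi$ holds in $X$ iff $\psi$ holds in $\{s[a/x]:s\in X,a\in A\}$. A sentence is true in $\mathfrak A$ iff satisfied by $\{\emptyset\}$. A generalized quantifier of type $(i_1,\dots,i_n)$ is an isomorphism-closed class $Q$ of structures $(A,B_1,\dots,B_n)$, $B_j\subseteq A^{i_j}$; the atom $A_Q(\bar y_1,\dots,\bar y_n)$ holds in $X$ iff $(A,\mathrm{rel}(X,\bar y_1),\dots,\mathrm{rel}(X,\bar y_n))\in Q$. $\mathrm{FO}^k(A_Q)$: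 first-order logic with $A_Q$-atoms using only variables $x_1,\dots,x_k$. $\mathrm{FOC}$: first-order logic with counting quantifiers $\exists^{\ge i}$; $\mathrm{FOC}^k$: its $k$-variable fragment; $\Sigma^1_1(\mathrm{FOC}^k)$: formulas $\exists X_1\dots\exists X_m\chi$, $\chi\in\mathrm{FOC}^k$. $A_Q$ (with all $i_j\le k$) is $\Sigma^1_1(\mathrm{FOC}^k)$-definable if there is a $\Sigma^1_1(\mathrm{FOC}^k)$-sentence $\varphi(R_1,\dots,R_n)$ ($R_j$ of arity $i_j$) with $\mathfrak A\models_X A_Q(\bar x_1,\dots,\bar x_n)$ iff $(\mathfrak A,R_j:=\mathrm{rel}(X,\bar x_j))_j\models\varphi$, for all $\mathfrak A$ and teams $X$ with codomain $A$ whose domain contains the relevant variables. *)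

(* Defs.v *)
From mathcomp Require Import all_boot finmap.
From mathcomp Require Import boolp classical_sets.

Set Implicit Arguments.
Unset Strict Implicit.
Unset Printing Implicit Defensive.

Local Open Scope fmap_scope.
Local Open Scope classical_set_scope.

Record vocab := Vocab { sym : Type; ar : sym -> nat }.

Record structure (tau : vocab) := Structure {
  dom :> Type;
  dom_inhabited : inhabited dom;
  rels : forall R : sym tau, set ((ar R).-tuple dom)
}.

Definition isomorphic (tau : vocab) (A B : structure tau) : Prop :=
  exists f : A -> B, bijective f /\
    forall (R : sym tau) (t : (ar R).-tuple A),
      rels t <-> rels (map_tuple f t).

(* The vocabulary {R_0, ..., R_(n-1)} with R_j of arity i j. *)
Definition typevoc (n : nat) (i : 'I_n -> nat) : vocab := @Vocab 'I_n i.

(* The disjoint union of tau and typevoc r. *)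
Definition extvoc (tau : vocab) (m : nat) (r : 'I_m -> nat) : vocab :=
  @Vocab (sym tau + 'I_m)%type
    (fun R => match R with inl R => ar R | inr j => r j end).

Definition expand (tau : vocab) (m : nat) (r : 'I_m -> nat) (A : structure tau)
    (B : forall j : 'I_m, set ((r j).-tuple A)) : structure (extvoc tau r) :=
  @Structure (extvoc tau r) A (dom_inhabited A)
    (fun R => match R with inl R => @rels tau A R | inr j => B j end).

(* The structure (A, B_1, ..., B_n) on the domain of A. *)
Definition with_rels (tau : vocab) (n : nat) (i : 'I_n -> nat)
    (A : structure tau) (B : forall j : 'I_n, set ((i j).-tuple A)) :
    structure (typevoc i) :=
  @Structure (typevoc i) A (dom_inhabited A) B.

Record gquant (n : nat) (i : 'I_n -> nat) := GQuant {
  gq_mem :> structure (typevoc i) -> Prop;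
  gq_iso : forall A B : structure (typevoc i),
    isomorphic A B -> gq_mem A -> gq_mem B
}.

(* The variable x_(j+1) is represented by j : nat, so that x_1, ..., x_k are
   the j < k. *)
Definition var := nat.

Definition asg (A : Type) := {fmap var -> A}.

(* vals s ys t: all of ys lie in the domain of s, and s(ys) = t. *)
Definition vals (A : Type) (s : asg A) (m : nat) (ys : m.-tuple var)
    (t : m.-tuple A) : Prop :=
  forall l : 'I_m, s.[? tnth ys l] = Some (tnth t l).

Definition team (A : Type) (D : {fset var}) (X : set (asg A)) : Prop :=
  forall s, X s -> domf s = D.

Definition rel_of (A : Type) (X : set (asg A)) (m : nat) (ys : m.-tuple var) :
    set (m.-tuple A) :=
  [set t | exists2 s, X s & vals s ys t].

Inductive tform (tau : vocab) (n : nat) (i : 'I_n -> nat) : Type :=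
| TRel (R : sym tau) (ys : (ar R).-tuple var)
| TNRel (R : sym tau) (ys : (ar R).-tuple var)
| TEq (x y : var)
| TNEq (x y : var)
| TAtom (ys : forall j : 'I_n, (i j).-tuple var)
| TAnd (f g : tform tau i)
| TOr (f g : tform tau i)
| TEx (x : var) (f : tform tau i)
| TAll (x : var) (f : tform tau i).

Arguments TRel {tau n i} R ys.
Arguments TNRel {tau n i} R ys.
Arguments TEq {tau n i} x y.
Arguments TNEq {tau n i} x y.
Arguments TAtom {tau n i} ys.

Fixpoint tfree (tau : vocab) (n : nat) (i : 'I_n -> nat) (f : tform tau i) :
    seq var :=
  match f with
  | TRel _ ys | TNRel _ ys => ys
  | TEq x y | TNEq x y => [:: x; y]
  | TAtom ys => flatten [seq tval (ys j) | j <- enum 'I_n]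
  | TAnd f g | TOr f g => tfree f ++ tfree g
  | TEx x f | TAll x f => [seq y <- tfree f | y != x]
  end.

(* All variables occurring in f, including those directly after a quantifier. *)
Fixpoint tvars (tau : vocab) (n : nat) (i : 'I_n -> nat) (f : tform tau i) :
    seq var :=
  match f with
  | TRel _ ys | TNRel _ ys => ys
  | TEq x y | TNEq x y => [:: x; y]
  | TAtom ys => flatten [seq tval (ys j) | j <- enum 'I_n]
  | TAnd f g | TOr f g => tvars f ++ tvars g
  | TEx x f | TAll x f => x :: tvars f
  end.

Definition FOk_sentence (k : nat) (tau : vocab) (n : nat) (i : 'I_n -> nat)
    (f : tform tau i) : Prop :=
  tfree f = [::] /\ forall x, x \in tvars f -> x < k.

(* Lax team semantics. A literal with a variable outside the domain of s fails
   at s; this never matters for sentences. *)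
Fixpoint tsat (tau : vocab) (n : nat) (i : 'I_n -> nat) (Q : gquant i)
    (A : structure tau) (X : set (asg A)) (f : tform tau i) : Prop :=
  match f with
  | TRel R ys => forall s, X s -> exists2 t, vals s ys t & @rels tau A R t
  | TNRel R ys => forall s, X s -> exists2 t, vals s ys t & ~ @rels tau A R t
  | TEq x y => forall s, X s ->
      exists a b, [/\ s.[? x] = Some a, s.[? y] = Some b & a = b]
  | TNEq x y => forall s, X s ->
      exists a b, [/\ s.[? x] = Some a, s.[? y] = Some b & a <> b]
  | TAtom ys => Q (with_rels (fun j => rel_of X (ys j)))
  | TAnd f g => tsat Q X f /\ tsat Q X g
  | TOr f g => exists Y Z, [/\ X = Y `|` Z, tsat Q Y f & tsat Q Z g]
  | TEx x f => exists F : asg A -> set A, (forall s, X s -> F s !=set0) /\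
      tsat Q [set u | exists s a, [/\ X s, F s a & u = s.[x <- a]]] f
  | TAll x f =>
      tsat Q [set u | exists s a, X s /\ u = s.[x <- a]] f
  end.

Definition ttrue (tau : vocab) (n : nat) (i : 'I_n -> nat) (Q : gquant i)
    (A : structure tau) (f : tform tau i) : Prop :=
  tsat Q (A := A) [set [fmap]] f.

Inductive foc (tau : vocab) : Type :=
| CRel (R : sym tau) (ys : (ar R).-tuple var)
| CEq (x y : var)
| CNot (f : foc tau)
| CAnd (f g : foc tau)
| COr (f g : foc tau)
| CEx (x : var) (f : foc tau)
| CAll (x : var) (f : foc tau)
| CGe (c : nat) (x : var) (f : foc tau).

Arguments CRel {tau} R ys.
Arguments CEq {tau} x y.

Fixpoint cfree (tau : vocab) (f : foc tau) : seq var :=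
  match f with
  | CRel _ ys => ys
  | CEq x y => [:: x; y]
  | CNot f => cfree f
  | CAnd f g | COr f g => cfree f ++ cfree g
  | CEx x f | CAll x f | CGe _ x f => [seq y <- cfree f | y != x]
  end.

Fixpoint cvars (tau : vocab) (f : foc tau) : seq var :=
  match f with
  | CRel _ ys => ys
  | CEq x y => [:: x; y]
  | CNot f => cvars f
  | CAnd f g | COr f g => cvars f ++ cvars g
  | CEx x f | CAll x f | CGe _ x f => x :: cvars f
  end.

Fixpoint csat (tau : vocab) (A : structure tau) (s : asg A) (f : foc tau) :
    Prop :=
  match f with
  | CRel R ys => exists2 t, vals s ys t & @rels tau A R t
  | CEq x y => exists a b, [/\ s.[? x] = Some a, s.[? y] = Some b & a = b]
  | CNot f => ~ csat s f
  | CAnd f g => csat s f /\ csat s g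
  | COr f g => csat s f \/ csat s g
  | CEx x f => exists a : A, csat s.[x <- a] f
  | CAll x f => forall a : A, csat s.[x <- a] f
  | CGe c x f => exists e : 'I_c -> A,
      injective e /\ forall l, csat s.[x <- e l] f
  end.

(* The formula "exists X_1 ... X_m, chi": X_(j+1) is the symbol inr j of arity
   so_ar j. *)
Record sigma11 (tau : vocab) := Sigma11 {
  so_num : nat;
  so_ar : 'I_so_num -> nat;
  so_matrix : foc (extvoc tau so_ar)
}.

Definition sigma11k_sentence (k : nat) (tau : vocab) (p : sigma11 tau) : Prop :=
  cfree (so_matrix p) = [::] /\ forall x, x \in cvars (so_matrix p) -> x < k.

Definition sigma11_true (tau : vocab) (A : structure tau) (p : sigma11 tau) :
    Prop :=
  exists B : forall j : 'I_(so_num p), set ((so_ar j).-tuple A),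
    csat (A := expand B) [fmap] (so_matrix p).

Definition sigma11k_definable (k : nat) (n : nat) (i : 'I_n -> nat)
    (Q : gquant i) : Prop :=
  (forall j, i j <= k) /\
  exists2 p : sigma11 (typevoc i), sigma11k_sentence k p &
    forall (tau : vocab) (A : structure tau) (D : {fset var})
      (X : set (asg A)) (xs : forall j : 'I_n, (i j).-tuple var),
      team D X -> (forall j x, x \in xs j -> x \in D) ->
      tsat Q X (TAtom xs) <->
      sigma11_true (with_rels (fun j => rel_of X (xs j))) p.

(* Main.v *)
(** A team [X] with domain [x_1, ..., x_k] is coded by the k-ary relation
    [rel(X, (x_1, ..., x_k))].  By locality one may start from the full team
    instead of the team [{∅}], so that all teams met in the evaluation of a
    sentence of FO^k(A_Q) have this domain.  One guesses a k-ary relation for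
    the team of every subformula occurrence and checks with k variables that
    consecutive guesses fit together.  For an atom [A_Q(ys_1, ..., ys_n)] one
    also guesses the relations [R_j = rel(X, ys_j)] and the witnesses of the
    defining sentence.  The inclusion [R_j ⊆ rel(X, ys_j)] needs a trick, since
    the tuple in [R_j] and the assignment in [X] have too many variables
    together: it says that the tuples in [R_j] satisfy every equality
    between components that [ys_j] imposes, and that [R_j(ys_j)] implies
    [∃zs X(x_1, ..., x_k)], where [zs] lists the variables outside [ys_j]. *)

Require Import Defs.
From mathcomp Require Import all_boot finmap.
From mathcomp Require Import boolp classical_sets.

Set Implicit Arguments.
Unset Strict Implicit.
Unset Printing Implicit Defensive.

Local Open Scope fmap_scope.
Local Open Scope classical_set_scope.

(** * Assignments *)

(** The effect of a block of quantifiers over [xs], independent of order and repetitions in the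
    block. *)
Definition reassigns (A : Type) (xs : seq var) (s s' : asg A) : Prop :=
  forall y, if y \in xs then (isSome s'.[? y] : Prop) else s'.[? y] = s.[? y].

(** The assignments with domain x_1, ..., x_k, put as what a block of quantifiers over these
    variables reaches from the empty assignment. *)
Definition full (k : nat) (A : Type) (s : asg A) : Prop :=
  reassigns (iota 0 k) [fmap] s.

Definition asg_of (A : Type) (f : var -> A) (xs : seq var) : asg A :=
  foldr (fun x s => s.[x <- f x]) [fmap] xs.

Lemma asg_ofE (A : Type) (f : var -> A) (xs : seq var) (y : var) :
  (asg_of f xs).[? y] = if y \in xs then Some (f y) else None.
Proof.
elim: xs => [|x xs IH] /=; first by rewrite fnd_fmap0.
by rewrite fnd_set inE IH; case: eqVneq => [->|].
Qed.

Lemma full_fnd (k : nat) (A : Type) (s : asg A) (x : var) :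
  full k s -> x < k -> exists a, s.[? x] = Some a.
Proof.
move=> /(_ x); rewrite mem_iota add0n /= => + xk; rewrite xk /=.
by case: (s.[? x]) => // a _; exists a.
Qed.

Lemma full_asg_of (k : nat) (A : Type) (f : var -> A) :
  full k (asg_of f (iota 0 k)).
Proof. by move=> y; rewrite asg_ofE; case: (y \in _); rewrite /= ?fnd_fmap0. Qed.

Lemma asg_of_lt (k : nat) (A : Type) (f : var -> A) (y : var) :
  y < k -> (asg_of f (iota 0 k)).[? y] = Some (f y).
Proof. by move=> yk; rewrite asg_ofE mem_iota add0n /= yk. Qed.

Lemma full_set (k : nat) (A : Type) (s : asg A) (x : var) (a : A) :
  x < k -> full k s -> full k s.[x <- a].
Proof.
move=> xk fs y; move: (fs y); rewrite mem_iota add0n /= fnd_set.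
by case: eqVneq => [->|//]; rewrite xk.
Qed.

Lemma full_reassigns (k : nat) (A : Type) (s s' : asg A) (xs : seq var) :
  (forall x, x \in xs -> x < k) -> full k s -> reassigns xs s s' -> full k s'.
Proof.
move=> xsk fs ss' y; move: (fs y) (ss' y); case: ifP => [yk|yk] + ; last first.
  move=> sy; case: ifP => [/xsk|_ ->//].
  by move: yk; rewrite mem_iota add0n => /= ->.
by move=> sy; case: ifP => // _ ->.
Qed.

Lemma domf_full (k : nat) (A : Type) (s : asg A) :
  full k s -> domf s = seq_fset tt (iota 0 k).
Proof.
move=> fs; apply/fsetP => y; rewrite seq_fsetE; move: (fs y).
by case: ifP => _; rewrite ?fnd_fmap0; case: fndP.
Qed.

Lemma set_get (A : Type) (s : asg A) (x : var) (a b : A) :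
  s.[? x] = Some b -> s.[x <- a].[x <- b] = s.
Proof. by move=> sx; apply/fmapP => y; rewrite !fnd_set; case: eqVneq => [->|]. Qed.

Lemma full_vals (k : nat) (A : Type) (s : asg A) (m : nat)
    (ys : m.-tuple var) :
  full k s -> (forall y, y \in tval ys -> y < k) -> exists t, vals s ys t.
Proof.
move=> fs ysk.
have /choice [f fP] (l : 'I_m) : exists a, s.[? tnth ys l] = Some a.
  by apply: full_fnd fs _; apply: ysk; apply: mem_tnth.
by exists [tuple f l | l < m] => l; rewrite tnth_mktuple.
Qed.

Lemma vals_unique (A : Type) (s : asg A) (m : nat) (ys : m.-tuple var)
    (t t' : m.-tuple A) :
  vals s ys t -> vals s ys t' -> t = t'.
Proof. by move=> st st'; apply: eq_from_tnth => l; move: (st l); rewrite st' => -[]. Qed.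

Lemma vals_agree (A : Type) (s s' : asg A) (m : nat) (ys : m.-tuple var)
    (t : m.-tuple A) :
  (forall y, y \in tval ys -> s.[? y] = s'.[? y]) -> vals s ys t -> vals s' ys t.
Proof. by move=> ss' st l; rewrite -ss' ?mem_tnth. Qed.

Lemma tnth_iota (k : nat) (l : 'I_k) : tnth (iota_tuple k 0) l = l.
Proof. by rewrite (tnth_nth 0) nth_iota. Qed.

Lemma vals_iota_inj (k : nat) (A : Type) (s s' : asg A) (t : k.-tuple A) :
  full k s -> full k s' ->
  vals s (iota_tuple k 0) t -> vals s' (iota_tuple k 0) t -> s = s'.
Proof.
move=> fs fs' st s't; apply/fmapP => y; have [yk|ky] := ltnP y k.
  by move: (st (Ordinal yk)) (s't (Ordinal yk)); rewrite tnth_iota => -> ->.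
by move: (fs y) (fs' y); rewrite mem_iota add0n /= ltnNge ky /= => -> ->.
Qed.

(** * Locality of team semantics *)

Definition agree_on (V : seq var) (A : Type) (s s' : asg A) : Prop :=
  forall y, y \in V -> s.[? y] = s'.[? y].

Definition team_le (V : seq var) (A : Type) (X Y : set (asg A)) : Prop :=
  forall s, X s -> exists2 s', Y s' & agree_on V s s'.

(** Equality of the restrictions of both teams to [V], without forming the restrictions. *)
Definition team_agree (V : seq var) (A : Type) (X Y : set (asg A)) : Prop :=
  team_le V X Y /\ team_le V Y X.

Lemma agree_sym (V : seq var) (A : Type) (s s' : asg A) :
  agree_on V s s' -> agree_on V s' s.
Proof. by move=> ss' y /ss'. Qed.

Lemma agree_sub (V W : seq var) (A : Type) (s s' : asg A) :
  {subset W <= V} -> agree_on V s s' -> agree_on W s s'.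
Proof. by move=> WV ss' y /WV/ss'. Qed.

Lemma agree_set (V : seq var) (A : Type) (s s' : asg A) (x : var) (a : A) :
  agree_on [seq y <- V | y != x] s s' -> agree_on V s.[x <- a] s'.[x <- a].
Proof.
move=> ss' y yV; rewrite !fnd_set; case: eqVneq => // yx.
by apply: ss'; rewrite mem_filter yx.
Qed.

Lemma team_agree_sub (V W : seq var) (A : Type) (X Y : set (asg A)) :
  {subset W <= V} -> team_agree V X Y -> team_agree W X Y.
Proof.
move=> WV [XY YX]; split=> s.
  by move=> /XY[s' Ys' ss']; exists s' => //; apply: agree_sub ss'.
by move=> /YX[s' Xs' ss']; exists s' => //; apply: agree_sub ss'.
Qed.

Lemma rel_of_agree (A : Type) (X Y : set (asg A)) (m : nat) (ys : m.-tuple var) :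
  team_agree ys X Y -> rel_of X ys = rel_of Y ys.
Proof.
move=> [XY YX]; apply/seteqP; split=> t [s] => [/XY|/YX] [s' ? ss'] st;
  by exists s' => //; apply: vals_agree st.
Qed.

(** Induction on [phi], transporting witnesses along agreeing assignments. The domains may differ,
    so the team of the empty assignment can be compared with a team of full ones. *)
Lemma team_locality (tau : vocab) (n : nat) (i : 'I_n -> nat) (Q : gquant i)
    (A : structure tau) (phi : tform tau i) (X Y : set (asg A)) :
  team_agree (tfree phi) X Y -> tsat Q X phi -> tsat Q Y phi.
Proof.
elim: phi X Y => [R ys|R ys|x y|x y|ys|f IHf g IHg|f IHf g IHg|x f IHf|x f IHf]
  X Y /=.
- move=> [_ YX] H s /YX[s' /H[t st Rt] ss']; exists t => //.
  by apply: vals_agree st; apply: agree_sym.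
- move=> [_ YX] H s /YX[s' /H[t st Rt] ss']; exists t => //.
  by apply: vals_agree st; apply: agree_sym.
- move=> [_ YX] H s /YX[s' /H[a [b [sa sb ab]]] ss']; exists a, b.
  by rewrite !ss' ?inE ?eqxx ?orbT.
- move=> [_ YX] H s /YX[s' /H[a [b [sa sb ab]]] ss']; exists a, b.
  by rewrite !ss' ?inE ?eqxx ?orbT.
- move=> XY; suff -> : (fun j => rel_of X (ys j)) = (fun j => rel_of Y (ys j)) by [].
  apply: functional_extensionality_dep => j; apply: rel_of_agree.
  apply: team_agree_sub XY => y yj; apply/flattenP; exists (tval (ys j)) => //.
  by apply/mapP; exists j; rewrite ?mem_enum.
- move=> XY [Xf Xg]; split.
    by apply: IHf Xf; apply: team_agree_sub XY => y yf; rewrite mem_cat yf.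
  by apply: IHg Xg; apply: team_agree_sub XY => y yg; rewrite mem_cat yg orbT.
- set V := _ ++ _; move=> [XY YX] [X1 [X2 [XE X1f X2g]]].
  (* A part of [X] becomes the set of all members of [Y] that agree with one of its members; lax
     disjunction lets the parts overlap. *)
  pose cut Z := [set s | Y s /\ exists2 s', Z s' & agree_on V s s'].
  have cutP Z : Z `<=` X -> team_agree V Z (cut Z).
    move=> ZX; split=> s; last by move=> [].
    move=> Zs; have [s' Ys' ss'] := XY _ (ZX _ Zs).
    by exists s' => //; split => //; exists s => //; apply: agree_sym.
  exists (cut X1), (cut X2); split.
  + apply/seteqP; split=> s; last by move=> [[]|[]].
    by move=> Ys; have [s'] := YX _ Ys; rewrite XE => -[X1s'|X2s'] ss';
      [left|right]; split => //; exists s'.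
  + apply: IHf X1f; apply: (@team_agree_sub V).
      by move=> y yf; rewrite mem_cat yf.
    by apply: cutP; rewrite XE; apply: subsetUl.
  + apply: IHg X2g; apply: (@team_agree_sub V).
      by move=> y yg; rewrite mem_cat yg orbT.
    by apply: cutP; rewrite XE; apply: subsetUr.
- set V := [seq _ <- _ | _]; move=> [XY YX] [F [Fne Ff]].
  (* An assignment of [Y] receives the choices of all its partners in [X]; following a single
     partner could lose members of the extended team. *)
  exists (fun s => [set a | exists s', [/\ X s', agree_on V s s' & F s' a]]).
  split.
    move=> s /YX[s' Xs' ss']; have [a Fa] := Fne _ Xs'.
    by exists a; exists s'.
  apply: IHf Ff; split=> u [s [a]].
    move=> [Xs Fsa ->]; have [s' Ys' ss'] := XY _ Xs.
    exists s'.[x <- a]; last exact: agree_set.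
    by exists s', a; split=> //; exists s; split=> //; apply: agree_sym.
  move=> [Ys [s' [Xs' ss' Fs'a]] ->]; exists s'.[x <- a]; last exact: agree_set.
  by exists s', a.
- move=> [XY YX]; apply: IHf; split=> u [s [a]] [].
    move=> /XY[s' Ys' ss'] ->; exists s'.[x <- a]; last exact: agree_set.
    by exists s', a.
  move=> /YX[s' Ys' ss'] ->; exists s'.[x <- a]; last exact: agree_set.
  by exists s', a.
Qed.

(** * Formulas with counting *)

Definition ksentence (k : nat) (tau : vocab) (f : foc tau) : Prop :=
  cfree f = [::] /\ forall x, x \in cvars f -> x < k.

Lemma cfree_sub_cvars (tau : vocab) (f : foc tau) : {subset cfree f <= cvars f}.
Proof.
elim: f => [R ys|x z|f IH|f IHf g IHg|f IHf g IHg|x f IH|x f IH|c x f IH] y //=;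
  rewrite ?mem_cat ?mem_filter ?inE.
- exact: IH.
- by case/orP => [/IHf|/IHg] ->; rewrite ?orbT.
- by case/orP => [/IHf|/IHg] ->; rewrite ?orbT.
- by case/andP => _ /IH ->; rewrite orbT.
- by case/andP => _ /IH ->; rewrite orbT.
- by case/andP => _ /IH ->; rewrite orbT.
Qed.

Lemma cvars_CEx (tau : vocab) (f : foc tau) (xs : seq var) :
  cvars (foldr (@CEx tau) f xs) = xs ++ cvars f.
Proof. by elim: xs => //= x xs ->. Qed.

Lemma cvars_CAll (tau : vocab) (f : foc tau) (xs : seq var) :
  cvars (foldr (@CAll tau) f xs) = xs ++ cvars f.
Proof. by elim: xs => //= x xs ->. Qed.

Lemma cfree_CAll (tau : vocab) (f : foc tau) (xs : seq var) :
  cfree (foldr (@CAll tau) f xs) = [seq y <- cfree f | y \notin xs].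
Proof.
elim: xs => [|x xs IH] /=; first by rewrite filter_predT.
by rewrite IH -filter_predI; apply: eq_filter => y; rewrite /= inE negb_or.
Qed.

Lemma ksentence_CAll (k : nat) (tau : vocab) (f : foc tau) :
  (forall x, x \in cvars f -> x < k) ->
  ksentence k (foldr (@CAll tau) f (iota 0 k)).
Proof.
move=> fk; split.
  rewrite cfree_CAll; apply/eqP; rewrite -[_ == _]negbK -has_filter.
  by apply/hasPn => y /cfree_sub_cvars/fk yk; rewrite mem_iota add0n /= yk.
by move=> x; rewrite cvars_CAll mem_cat mem_iota add0n /= => /orP[|/fk].
Qed.

Lemma reassigns_cons (A : Type) (x : var) (xs : seq var) (s s' : asg A) :
  reassigns (x :: xs) s s' <-> exists a, reassigns xs s.[x <- a] s'.
Proof.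
split=> [ss'|[a ss'] y].
  move: (ss' x); rewrite inE eqxx /=; case s'x : (s'.[? x]) => [a|//] _.
  exists a => y; move: (ss' y); rewrite inE fnd_set.
  by case: eqVneq => [->|//]; rewrite s'x; case: ifP.
move: (ss' y); rewrite inE fnd_set.
by case: eqVneq => [->|//]; case: ifP => // _ ->.
Qed.

Lemma reassigns_nil (A : Type) (s s' : asg A) : reassigns [::] s s' <-> s' = s.
Proof. by split=> [ss'|-> //]; apply/fmapP. Qed.

Lemma csat_CAll (tau : vocab) (A : structure tau) (f : foc tau)
    (xs : seq var) (s : asg A) :
  csat s (foldr (@CAll tau) f xs) <-> forall s', reassigns xs s s' -> csat s' f.
Proof.
elim: xs s => [|x xs IH] s /=.
  by split=> [H s' /reassigns_nil ->//|]; apply; apply/reassigns_nil.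
split=> [H s' /reassigns_cons[a ss']|H a]; first exact: (IH _).1 (H a) _ ss'.
by apply/IH => s' ss'; apply: H; apply/reassigns_cons; exists a.
Qed.

Lemma csat_CEx (tau : vocab) (A : structure tau) (f : foc tau)
    (xs : seq var) (s : asg A) :
  csat s (foldr (@CEx tau) f xs) <-> exists2 s', reassigns xs s s' & csat s' f.
Proof.
elim: xs s => [|x xs IH] s /=.
  by split=> [H|[s' /reassigns_nil ->//]]; exists s => //; apply/reassigns_nil.
split=> [[a /IH[s' ss' s'f]]|[s' /reassigns_cons[a ss'] s'f]].
  by exists s' => //; apply/reassigns_cons; exists a.
by exists a; apply/IH; exists s'.
Qed.

(** * Renaming of relation symbols along an arity-preserving map *)

Section Rename.

Variables (tau tau' : vocab) (h : sym tau -> sym tau').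
Hypothesis e : forall R, ar R = ar (h R).

Fixpoint rename (f : foc tau) : foc tau' :=
  match f with
  | CRel R ys => @CRel tau' (h R) (tcast (e R) ys)
  | CEq x y => @CEq tau' x y
  | CNot f => CNot (rename f)
  | CAnd f g => CAnd (rename f) (rename g)
  | COr f g => COr (rename f) (rename g)
  | CEx x f => CEx x (rename f)
  | CAll x f => CAll x (rename f)
  | CGe c x f => CGe c x (rename f)
  end.

Lemma cvars_rename f : cvars (rename f) = cvars f.
Proof.
by elim: f => //= [R ys|f -> g ->|f -> g ->|x f ->|x f ->|c x f ->] //;
  rewrite val_tcast.
Qed.

Lemma cfree_rename f : cfree (rename f) = cfree f.
Proof.
by elim: f => //= [R ys|f -> g ->|f -> g ->|x f ->|x f ->|c x f ->] //;
  rewrite val_tcast.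
Qed.

Lemma ksentence_rename k f : ksentence k f -> ksentence k (rename f).
Proof. by rewrite /ksentence cvars_rename cfree_rename. Qed.

Lemma vals_tcast (A : Type) (s : asg A) (m m' : nat) (eq_m : m = m')
    (ys : m.-tuple var) (t : m.-tuple A) :
  vals s (tcast eq_m ys) (tcast eq_m t) <-> vals s ys t.
Proof. by case: m' / eq_m. Qed.

(** Both structures are built on the same type [D], so one assignment serves both sides. Symbols
    outside the image of [h] are unconstrained. *)
Lemma csat_rename (D : Type) (iD iD' : inhabited D)
    (r : forall R : sym tau, set ((ar R).-tuple D))
    (r' : forall R : sym tau', set ((ar R).-tuple D)) :
  (forall R t, r R t <-> r' (h R) (tcast (e R) t)) ->
  forall (f : foc tau) (s : asg D),
    csat (A := Structure iD r) s f <-> csat (A := Structure iD' r') s (rename f).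
Proof.
move=> rr'; elim=> [R ys|x y|f IH|f IHf g IHg|f IHf g IHg|x f IH|x f IH|c x f IH] s //=.
- split=> [[t st Rt]|[t st Rt]].
    by exists (tcast (e R) t); [apply/vals_tcast | apply/rr'].
  exists (tcast (esym (e R)) t); last by apply/rr'; rewrite tcastKV.
  by rewrite -(vals_tcast _ (e R)) tcastKV.
- by rewrite IH.
- by rewrite IHf IHg.
- by rewrite IHf IHg.
- by split=> -[a Ha]; exists a; apply/IH.
- by split=> Ha a; apply/IH.
- by split=> -[g [ginj Hg]]; exists g; split=> // l; apply/IH.
Qed.

(** Besides forgetting symbols, this can reinterpret them: a guessed team can take the place of the
    current one. *)
Definition reduct (A : structure tau') : structure tau :=
  Structure (dom_inhabited A) (fun R t => @rels tau' A (h R) (tcast (e R) t)).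

End Rename.

(** * Classes of structures definable by existential second-order sentences *)

(* As [extvoc], [expand] and [sigma11], but the new symbols are indexed by an
   arbitrary (finite) type, so that unions of index sets are plain sums. *)
Definition sumvoc (tau : vocab) (I : Type) (r : I -> nat) : vocab :=
  @Vocab (sym tau + I)%type
    (fun R => match R with inl R => ar R | inr j => r j end).

Definition sumexp (tau : vocab) (I : Type) (r : I -> nat) (A : structure tau)
    (B : forall j : I, set ((r j).-tuple A)) : structure (sumvoc tau r) :=
  @Structure (sumvoc tau r) A (dom_inhabited A)
    (fun R => match R with inl R => @rels tau A R | inr j => B j end).

(** Definability is treated as a property of classes, so that formulas arise from closure properties
    and second-order prefixes are merged inside those lemmas. *)
Definition sigma11k_class (k : nat) (tau : vocab) (C : structure tau -> Prop) :
    Prop :=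
  exists (I : finType) (r : I -> nat) (chi : foc (sumvoc tau r)),
    ksentence k chi /\
    forall A, C A <-> exists B : forall j, set ((r j).-tuple A),
      csat (A := sumexp B) [fmap] chi.

Lemma sigma11k_class_ext (k : nat) (tau : vocab) (C C' : structure tau -> Prop) :
  (forall A, C A <-> C' A) -> sigma11k_class k C -> sigma11k_class k C'.
Proof.
move=> CC' [I [r [chi [chik CP]]]]; exists I, r, chi; split=> // A.
by rewrite -CC' CP.
Qed.

Lemma sigma11k_class_sigma11 (k : nat) (tau : vocab) (p : sigma11 tau) :
  sigma11k_sentence k p -> sigma11k_class k (fun A => sigma11_true A p).
Proof.
by move=> pk; exists 'I_(so_num p), (@so_ar _ p), (so_matrix p).
Qed.

Lemma sigma11_of_class (k : nat) (tau : vocab) (C : structure tau -> Prop) :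
  sigma11k_class k C ->
  exists2 p : sigma11 tau, sigma11k_sentence k p &
    forall A, C A <-> sigma11_true A p.
Proof.
move=> [I [r [chi [chik CP]]]].
pose r' (j : 'I_#|I|) := r (enum_val j).
pose h (R : sym (sumvoc tau r)) : sym (extvoc tau r') :=
  match R with inl R => inl R | inr j => inr (enum_rank j) end.
have er j : r j = r' (enum_rank j) by rewrite /r' enum_rankK.
pose e (R : sym (sumvoc tau r)) : ar R = ar (h R) :=
  match R with inl R => erefl | inr j => er j end.
exists (Sigma11 (rename e chi)); first exact: ksentence_rename.
move=> A; rewrite CP; split=> [[B Bchi]|[B Bchi]].
  exists (fun j => B (enum_val j)).
  refine (iffLR (@csat_rename _ _ _ e A _ _ _ _ _ chi _) Bchi) => -[R|j] t //=.
  (* Generalizing the arity equation lets [enum_rankK] rewrite its type too, which leaves a cast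
     along an equation between identical arities. *)
  move: (er j); rewrite /r' => E; move: E.
  rewrite enum_rankK => E; by rewrite tcast_id.
exists (fun j t => B (enum_rank j) (tcast (er j) t)).
by refine (iffRL (@csat_rename _ _ _ e A _ _ _ _ _ chi _) Bchi) => -[R|j] t.
Qed.

(** No relation is guessed, hence the index type [void]; quantifying all k variables closes [f]. *)
Lemma sigma11k_class_forall (k : nat) (tau : vocab) (f : foc tau) :
  (forall x, x \in cvars f -> x < k) ->
  sigma11k_class k (fun A => forall s : asg A, full k s -> csat s f).
Proof.
move=> fk; pose r (v : void) : nat := match v with end.
pose h (R : sym tau) : sym (sumvoc tau r) := inl R.
pose e (R : sym tau) : ar R = ar (h R) := erefl.
exists void, r, (rename e (foldr (@CAll tau) f (iota 0 k))).
split; first by apply: ksentence_rename; apply: ksentence_CAll.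
move=> [D iD rD]; rewrite -(csat_CAll _ _ [fmap]); split=> [H|[B H]].
  have B (j : void) : set ((r j).-tuple D) by [].
  by exists B; refine (iffLR (@csat_rename _ _ _ e D _ _ _ _ _ _ _) H).
by refine (iffRL (@csat_rename _ _ _ e D _ _ _ _ _ _ _) H).
Qed.

(** The index type [I + I'] keeps the guessed symbols apart, so the two prefixes merge into one. *)
Lemma sigma11k_class_and (k : nat) (tau : vocab) (C C' : structure tau -> Prop) :
  sigma11k_class k C -> sigma11k_class k C' ->
  sigma11k_class k (fun A => C A /\ C' A).
Proof.
move=> [I [r [f [fk CP]]]] [I' [r' [f' [f'k C'P]]]].
pose r2 (j : I + I') := match j with inl j => r j | inr j => r' j end.
pose h (R : sym (sumvoc tau r)) : sym (sumvoc tau r2) :=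
  match R with inl R => inl R | inr j => inr (inl j) end.
pose h' (R : sym (sumvoc tau r')) : sym (sumvoc tau r2) :=
  match R with inl R => inl R | inr j => inr (inr j) end.
pose e R : ar R = ar (h R) := match R with inl _ => erefl | inr _ => erefl end.
pose e' R : ar R = ar (h' R) := match R with inl _ => erefl | inr _ => erefl end.
exists (I + I')%type, r2, (CAnd (rename e f) (rename e' f')); split.
  have [f0 fv] := ksentence_rename e fk; have [f'0 f'v] := ksentence_rename e' f'k.
  split=> /=; first by rewrite f0 f'0.
  by move=> x; rewrite mem_cat => /orP[/fv|/f'v].
move=> A; rewrite CP C'P; split=> [[[B Bf] [B' Bf']]|[B [Bf Bf']]].
  exists (fun j => match j return set ((r2 j).-tuple A) with
                   | inl j => B j | inr j => B' j end).
  by split; [refine (iffLR (@csat_rename _ _ _ e A _ _ _ _ _ f _) Bf)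
            | refine (iffLR (@csat_rename _ _ _ e' A _ _ _ _ _ f' _) Bf')] => -[].
split.
  exists (fun j => B (inl j)).
  by refine (iffRL (@csat_rename _ _ _ e A _ _ _ _ _ f _) Bf) => -[].
exists (fun j => B (inr j)).
by refine (iffRL (@csat_rename _ _ _ e' A _ _ _ _ _ f' _) Bf') => -[].
Qed.

(** The universal closure of x_1 = x_1 serves as truth; its variable is where [0 < k] enters. *)
Lemma sigma11k_class_true (k : nat) (tau : vocab) :
  0 < k -> sigma11k_class k (fun _ : structure tau => True).
Proof.
move=> k0; apply: sigma11k_class_ext (@sigma11k_class_forall k tau (CEq 0 0) _).
  move=> A; split=> // _ s fs; have [a sa] := full_fnd fs k0.
  by exists a, a.
by move=> x; rewrite !inE orbb => /eqP ->.
Qed.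

Lemma sigma11k_class_all (k : nat) (tau : vocab) (J : finType)
    (C : J -> structure tau -> Prop) :
  0 < k -> (forall j, sigma11k_class k (C j)) ->
  sigma11k_class k (fun A => forall j, C j A).
Proof.
move=> k0 CP.
suff H (s : seq J) : sigma11k_class k (fun A => forall j, j \in s -> C j A).
  apply: sigma11k_class_ext (H (enum J)) => A; split=> [H1 j|H1 j _] //.
  by apply: H1; rewrite mem_enum.
elim: s => [|j s IH].
  by apply: sigma11k_class_ext (sigma11k_class_true tau k0).
apply: sigma11k_class_ext (sigma11k_class_and (CP j) IH) => A; split.
  by move=> [Cj Cs] l; rewrite inE => /predU1P[->|/Cs].
by move=> Cs; split=> [|l ls]; apply: Cs; rewrite inE ?eqxx ?ls ?orbT.
Qed.

Lemma sigma11k_class_reduct (k : nat) (tau tau' : vocab)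
    (h : sym tau -> sym tau') (e : forall R, ar R = ar (h R))
    (C : structure tau -> Prop) :
  sigma11k_class k C -> sigma11k_class k (fun A => C (reduct e A)).
Proof.
move=> [I [r [f [fk CP]]]].
pose h2 (R : sym (sumvoc tau r)) : sym (sumvoc tau' r) :=
  match R with inl R => inl (h R) | inr j => inr j end.
pose e2 R : ar R = ar (h2 R) := match R with inl R => e R | inr _ => erefl end.
exists I, r, (rename e2 f); split; first exact: ksentence_rename.
move=> A; rewrite CP; split=> -[B Bf]; exists B.
  by refine (iffLR (@csat_rename _ _ _ e2 A _ _ _ _ _ f _) Bf) => -[].
by refine (iffRL (@csat_rename _ _ _ e2 A _ _ _ _ _ f _) Bf) => -[].
Qed.

(** Guessing [B] and then the witnesses of [C] amounts to one guess indexed by [J + I]. *)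
Lemma sigma11k_class_ex (k : nat) (tau : vocab) (J : finType) (r : J -> nat)
    (C : structure (sumvoc tau r) -> Prop) :
  sigma11k_class k C ->
  sigma11k_class k (fun A => exists B : forall j, set ((r j).-tuple A),
    C (sumexp B)).
Proof.
move=> [I [r' [f [fk CP]]]].
pose r2 (j : J + I) := match j with inl j => r j | inr j => r' j end.
pose h (R : sym (sumvoc (sumvoc tau r) r')) : sym (sumvoc tau r2) :=
  match R with
  | inl (inl R) => inl R | inl (inr j) => inr (inl j) | inr j => inr (inr j)
  end.
pose e R : ar R = ar (h R) :=
  match R with inl (inl _) => erefl | inl (inr _) => erefl | inr _ => erefl end.
exists (J + I)%type, r2, (rename e f); split; first exact: ksentence_rename.
move=> A; split=> [[B /CP[B' Bf]]|[B Bf]].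
  exists (fun j => match j return set ((r2 j).-tuple A) with
                   | inl j => B j | inr j => B' j end).
  by refine (iffLR (@csat_rename _ _ _ e A _ _ _ _ _ f _) Bf) => -[[]|].
exists (fun j => B (inl j)); apply/CP; exists (fun j => B (inr j)).
by refine (iffRL (@csat_rename _ _ _ e A _ _ _ _ _ f _) Bf) => -[[]|].
Qed.

(** * Teams coded by relations *)

(** Inverse to [rel_of] along x_1, ..., x_k on teams of full assignments. The conjunct [full k s]
    excludes assignments with further variables. *)
Definition team_of (k : nat) (A : Type) (S : set (k.-tuple A)) : set (asg A) :=
  [set s | full k s /\ exists2 t, vals s (iota_tuple k 0) t & S t].

Lemma team_of_rel_of (k : nat) (A : Type) (X : set (asg A)) :
  (forall s, X s -> full k s) -> team_of (rel_of X (iota_tuple k 0)) = X.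
Proof.
move=> Xk; apply/seteqP; split=> s.
  move=> [fs [t st [s' Xs' s't]]].
  by rewrite (vals_iota_inj fs (Xk _ Xs') st s't).
move=> Xs; have fs := Xk _ Xs; split=> //.
have [t st] : exists t, vals s (iota_tuple k 0) t.
  by apply: full_vals fs _ => y; rewrite mem_iota.
by exists t => //; exists s.
Qed.

(** The third condition gives each tuple of [R] the equality pattern of [ys]. Such a tuple is the
    value of [ys] at some full assignment, to which the second condition applies. *)
Lemma rel_of_eqP (k : nat) (A : Type) (X : set (asg A)) (m : nat)
    (ys : m.-tuple var) (R : set (m.-tuple A)) :
  inhabited A -> (forall s, X s -> full k s) -> m <= k ->
  (forall y, y \in tval ys -> y < k) ->
  R = rel_of X ys <->
  [/\ forall s, full k s -> X s -> exists2 t, vals s ys t & R t,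
      forall s, full k s -> (exists2 t, vals s ys t & R t) ->
        exists2 s', reassigns [seq x <- iota 0 k | x \notin tval ys] s s' & X s' &
      forall a b : 'I_m, tnth ys a = tnth ys b -> forall s, full k s ->
        (exists2 t, vals s (iota_tuple m 0) t & R t) ->
        exists c d : A, [/\ s.[? val a] = Some c, s.[? val b] = Some d & c = d]].
Proof.
move=> [a0] Xk mk ysk; split=> [->|[RX XR Req]].
  split=> [s fs Xs|s fs [t st [s' Xs' s't]]|a b yab s fs [t st [s' Xs' s't]]].
  - by have [t st] := full_vals fs ysk; exists t => //; exists s.
  (* The assignment [s'] already reassigns [s]: on [ys] both have the values [t], and from [k] on
     both are undefined. *)
  - exists s' => // y; rewrite mem_filter mem_iota add0n /=.
    case: (boolP (y \in tval ys)) => [/tnthP[l ->]|_] /=; first by rewrite st s't.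
    move: (Xk _ Xs' y) (fs y); rewrite mem_iota add0n /=.
    by case: (y < k) => // -> ->.
  - exists (tnth t a), (tnth t b); split.
    + by rewrite -(st a) tnth_iota.
    + by rewrite -(st b) tnth_iota.
    + by have := s't a; rewrite yab s't => -[].
apply/seteqP; split=> t; last first.
  move=> [s Xs st]; have [t' st' Rt'] := RX s (Xk _ Xs) Xs.
  by rewrite (vals_unique st st').
move=> Rt.
(* The third condition is applied with [t] stored in the first [m] variables, which exist by
   [m <= k]; the others get the default [a0]. *)
have teq (a b : 'I_m) : tnth ys a = tnth ys b -> tnth t a = tnth t b.
  move=> yab; pose s := asg_of (nth a0 t) (iota 0 k).
  have sE (l : 'I_m) : s.[? val l] = Some (tnth t l).
    by rewrite asg_of_lt ?(tnth_nth a0) // (leq_trans (ltn_ord l)).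
  have [|c [d []]] := Req _ _ yab s (full_asg_of _ _).
    by exists t => // l; rewrite tnth_iota sE.
  by rewrite !sE => -[->] [->].
(* Each variable takes the entry of [t] at its first position in [ys], or [a0] if it does not occur
   there; [teq] covers repeated occurrences. *)
pose s := asg_of (fun y => nth a0 t (index y ys)) (iota 0 k).
have st : vals s ys t.
  move=> l; rewrite asg_of_lt ?ysk ?mem_tnth //; congr Some.
  have il : index (tnth ys l) ys < m.
    by rewrite -[X in _ < X](size_tuple ys) index_mem mem_tnth.
  rewrite -[index _ _]/(val (Ordinal il)) -tnth_nth; apply: teq.
  by rewrite (tnth_nth 0) nth_index ?mem_tnth.
have [|s' ss' Xs'] := XR s (full_asg_of _ _); first by exists t.
exists s' => //; apply: vals_agree st => y yys.
by move: (ss' y); rewrite mem_filter yys.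
Qed.

(** * Structures with a coded team, and guessing of further teams *)

Definition CImp (tau : vocab) (f g : foc tau) : foc tau := COr (CNot f) g.

Lemma csat_CImp (tau : vocab) (A : structure tau) (s : asg A) (f g : foc tau) :
  csat s (CImp f g) <-> (csat s f -> csat s g).
Proof.
split=> /= [[nf /nf|]|fg] //.
by have [/fg|] := pselect (csat s f); [right|left].
Qed.

Lemma csat_CAnd (tau : vocab) (A : structure tau) (s : asg A) (f g : foc tau) :
  csat s (CAnd f g) <-> csat s f /\ csat s g.
Proof. by []. Qed.

Definition base (tau : vocab) (I : Type) (r : I -> nat)
    (A : structure (sumvoc tau r)) : structure tau :=
  Structure (dom_inhabited A) (fun R => @rels _ A (inl R)).

(* The vocabulary [tau] with a k-ary symbol for the current team. *)
Definition teamvoc (tau : vocab) (k : nat) : vocab := sumvoc tau (fun _ : unit => k).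

Definition cur_team (tau : vocab) (k : nat) (A : structure (teamvoc tau k)) :
    set (asg A) :=
  team_of (@rels (teamvoc tau k) A (inr tt)).

(** The object of the induction on formulas: the team is an additional relation, so satisfaction in
    a team becomes a property of ordinary structures. *)
Definition team_class (k : nat) (tau : vocab) (n : nat) (i : 'I_n -> nat)
    (Q : gquant i) (phi : tform tau i) (A : structure (teamvoc tau k)) : Prop :=
  tsat Q (A := base A) (cur_team (A := A)) phi.

Definition cur_atom (tau : vocab) (k : nat) (I : Type) (r : I -> nat) :
    foc (sumvoc (teamvoc tau k) r) :=
  @CRel (sumvoc (teamvoc tau k) r) (inl (inr tt)) (iota_tuple k 0).

Definition new_atom (tau : vocab) (I : Type) (r : I -> nat) (j : I)
    (ys : (r j).-tuple var) : foc (sumvoc tau r) :=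
  @CRel (sumvoc tau r) (inr j) ys.

(** Literals are flat, hence first-order over the team relation. *)
Lemma literal_class (k : nat) (tau : vocab) (f : foc tau) :
  (forall x, x \in cvars f -> x < k) ->
  sigma11k_class k (fun A : structure (teamvoc tau k) =>
    forall s, cur_team (A := A) s -> csat (A := base A) s f).
Proof.
move=> fk; pose h (R : sym tau) : sym (teamvoc tau k) := inl R.
pose e R : ar R = ar (h R) := erefl.
pose g := CImp (@CRel (teamvoc tau k) (inr tt) (iota_tuple k 0)) (rename e f).
apply: sigma11k_class_ext (@sigma11k_class_forall k _ g _).
  move=> A; have fE (s : asg A) : csat (A := base A) s f <-> csat s (rename e f).
    by case: A s => D iD r s; apply: (@csat_rename _ _ _ e D).
  split=> H s.
    by move=> [fs St]; apply/fE; apply: (iffLR (csat_CImp _ _ _) (H s fs)).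
  by move=> fs; apply/csat_CImp => St; apply/fE; apply: H.
move=> x; rewrite /= cvars_rename mem_cat mem_iota add0n /=.
by case/orP => // /fk.
Qed.

(** The common pattern of disjunction and both quantifiers: guess new teams, compare them with the
    current one by [fits], and require the subformulas in them. *)
Lemma guess_class (k : nat) (tau : vocab) (n : nat) (i : 'I_n -> nat)
    (Q : gquant i) (J : finType) (psi : J -> tform tau i)
    (fits : foc (sumvoc (teamvoc tau k) (fun _ : J => k))) :
  0 < k -> (forall x, x \in cvars fits -> x < k) ->
  (forall j, sigma11k_class k (team_class (k := k) Q (psi j))) ->
  sigma11k_class k (fun A : structure (teamvoc tau k) =>
    exists B : J -> set (k.-tuple A),
      (forall s : asg A, full k s -> csat (A := sumexp B) s fits) /\
      forall j, tsat Q (A := base A) (team_of (B j)) (psi j)).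
Proof.
move=> k0 fk psiP.
(* The guessed symbol [j] plays the role of the current team for [psi j]. *)
pose h (j : J) (R : sym (teamvoc tau k)) :
    sym (sumvoc (teamvoc tau k) (fun _ : J => k)) :=
  match R with inl R => inl (inl R) | inr _ => inr j end.
pose e j R : ar R = ar (h j R) :=
  match R with inl _ => erefl | inr _ => erefl end.
have H1 := sigma11k_class_all k0 (fun j => sigma11k_class_reduct (e j) (psiP j)).
exact: sigma11k_class_ex (sigma11k_class_and (sigma11k_class_forall fk) H1).
Qed.

(** * Connectives and quantifiers *)

Lemma team_class_and (k : nat) (tau : vocab) (n : nat) (i : 'I_n -> nat)
    (Q : gquant i) (f g : tform tau i) :
  sigma11k_class k (team_class (k := k) Q f) ->
  sigma11k_class k (team_class (k := k) Q g) ->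
  sigma11k_class k (team_class (k := k) Q (TAnd f g)).
Proof. exact: sigma11k_class_and. Qed.

(** Here [fits] says that the current team is the union of the two guessed ones. *)
Lemma team_class_or (k : nat) (tau : vocab) (n : nat) (i : 'I_n -> nat)
    (Q : gquant i) (f g : tform tau i) :
  0 < k ->
  sigma11k_class k (team_class (k := k) Q f) ->
  sigma11k_class k (team_class (k := k) Q g) ->
  sigma11k_class k (team_class (k := k) Q (TOr f g)).
Proof.
move=> k0 fP gP; pose S := @cur_atom tau k bool (fun _ => k).
pose T b := @new_atom (teamvoc tau k) bool (fun _ => k) b (iota_tuple k 0).
pose fits := CAnd (CImp S (COr (T true) (T false)))
                  (CAnd (CImp (T true) S) (CImp (T false) S)).
apply: sigma11k_class_ext
  (@guess_class k tau n i Q bool (fun b => if b then f else g) fits k0 _ _).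
- move=> A; split=> [[B [Bfits Bfg]]|[Y [Z [XE Yf Zg]]]].
    exists (team_of (B true)), (team_of (B false)); split.
    + apply/seteqP; split=> s.
        move=> [fs Ss]; have /csat_CAnd[/csat_CImp H _] := Bfits s fs.
        by have [] := H Ss; [left|right].
      by move=> [] [fs Ts];
        have /csat_CAnd[_ /csat_CAnd[/csat_CImp H1 /csat_CImp H2]] := Bfits s fs;
        split=> //; [apply: H1|apply: H2].
    + exact: (Bfg true).
    + exact: (Bfg false).
  pose X b := if b then Y else Z.
  (* Both parts lie in the current team, so they consist of full assignments and can be coded. *)
  have Xk b s : X b s -> full k s.
    move=> Xs; have [] // : cur_team (A := A) s.
    by rewrite XE; case: b Xs; [left|right].
  pose B (b : bool) : set (k.-tuple A) := rel_of (X b) (iota_tuple k 0).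
  have BX b : team_of (B b) = X b by apply: team_of_rel_of; apply: Xk.
  exists B; split=> [s fs|[]]; last 2 first.
  + by rewrite (BX true).
  + by rewrite (BX false).
  have TX b : csat (A := sumexp B) s (T b) <-> X b s.
    by rewrite -BX; split=> [|[]].
  have SX : csat (A := sumexp B) s S <-> X true s \/ X false s.
    rewrite -[X true s \/ X false s]/((Y `|` Z) s) -XE.
    by split=> [|[]].
  rewrite !csat_CAnd !csat_CImp.
  split; first by move=> /SX[/TX|/TX]; [left|right].
  by split=> /TX Xs; apply/SX; [left|right].
- move=> x; rewrite /= !mem_cat !mem_iota !add0n /=.
  by rewrite !orbb.
- by case.
Qed.

(** The first half of [fits] makes the choice sets nonempty; the second says that each new
    assignment is a variant at [x] of an old one. *)
Lemma team_class_ex (k : nat) (tau : vocab) (n : nat) (i : 'I_n -> nat)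
    (Q : gquant i) (x : var) (f : tform tau i) :
  0 < k -> x < k ->
  sigma11k_class k (team_class (k := k) Q f) ->
  sigma11k_class k (team_class (k := k) Q (TEx x f)).
Proof.
move=> k0 xk fP; pose S := @cur_atom tau k unit (fun _ => k).
pose T := @new_atom (teamvoc tau k) unit (fun _ => k) tt (iota_tuple k 0).
pose fits := CAnd (CImp S (CEx x T)) (CImp T (CEx x S)).
apply: sigma11k_class_ext (@guess_class k tau n i Q unit (fun _ => f) fits k0 _ _).
- move=> A; split=> [[B [Bfits Bf]]|[F [Fne Ff]]].
    (* The largest choice function into the guessed team, available because lax choices are sets. *)
    exists (fun s => [set a | team_of (B tt) s.[x <- a]]); split.
      move=> s [fs Ss]; have /csat_CAnd[/csat_CImp H _] := Bfits s fs.
      by have [a Ta] := H Ss; exists a; split=> //; apply: full_set.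
    suff -> : [set u | exists s a, [/\ cur_team (A := A) s,
        team_of (B tt) s.[x <- a] & u = s.[x <- a]]] = team_of (B tt).
      exact: (Bf tt).
    apply/seteqP; split=> [u [s [a [_ Ts ->]]] //|u Tu].
    have [fu Ttu] := Tu; have /csat_CAnd[_ /csat_CImp H] := Bfits u fu.
    have [a Sa] := H Ttu; have [b ub] := full_fnd fu xk.
    (* An old assignment [u.[x <- a]] yields [u] when the value [b] of [u] at [x] is put back. *)
    exists u.[x <- a], b; rewrite set_get //; split=> //.
    by split=> //; apply: full_set.
  set X := [set _ | _] in Ff.
  have Xk s : X s -> full k s by move=> [s' [a [[fs' _] _ ->]]]; apply: full_set.
  pose B (_ : unit) : set (k.-tuple A) := rel_of X (iota_tuple k 0).
  have BX : team_of (B tt) = X by apply: team_of_rel_of.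
  exists B; split=> [s fs|[]]; last by rewrite BX.
  apply/csat_CAnd; split; apply/csat_CImp.
    move=> Ss; have Cs : cur_team (A := A) s by [].
    have [a Fa] := Fne _ Cs; exists a.
    have : X s.[x <- a] by exists s, a.
    by rewrite -BX => -[].
  move=> Ts; have : team_of (B tt) s by [].
  rewrite BX => -[s' [a [[fs' Ss'] _ sE]]]; have [b sb] := full_fnd fs' xk.
  by exists b; rewrite sE set_get.
- move=> y; rewrite /= ?inE ?mem_cat ?inE !mem_iota !add0n /=.
  by case: eqVneq => [->|_]; rewrite ?xk //= ?orbb.
- by [].
Qed.

(** Unlike in the existential case, all variants at [x] of an old assignment are required, so [fits]
    determines the guessed team. *)
Lemma team_class_all (k : nat) (tau : vocab) (n : nat) (i : 'I_n -> nat)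
    (Q : gquant i) (x : var) (f : tform tau i) :
  0 < k -> x < k ->
  sigma11k_class k (team_class (k := k) Q f) ->
  sigma11k_class k (team_class (k := k) Q (TAll x f)).
Proof.
move=> k0 xk fP; pose S := @cur_atom tau k unit (fun _ => k).
pose T := @new_atom (teamvoc tau k) unit (fun _ => k) tt (iota_tuple k 0).
pose fits := CAnd (CImp (CEx x S) T) (CImp T (CEx x S)).
apply: sigma11k_class_ext (@guess_class k tau n i Q unit (fun _ => f) fits k0 _ _).
- move=> A; set C := team_class _ _.
  pose X : set (asg A) := [set u | exists s a, cur_team (A := A) s /\ u = s.[x <- a]].
  have Xk s : X s -> full k s by move=> [s' [a [[fs' _] ->]]]; apply: full_set.
  (* Being a variant at [x] is symmetric for full assignments, so the extended team is defined by
     quantifying [x] over the old one. *)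
  have XE s : full k s -> X s <-> exists a, cur_team (A := A) s.[x <- a].
    move=> fs; have [b sb] := full_fnd fs xk; split=> [[s' [a [Cs' sE]]]|[a Ca]].
      have [fs' _] := Cs'; have [c s'c] := full_fnd fs' xk.
      by exists c; rewrite sE set_get.
    by exists s.[x <- a], b; rewrite set_get.
  rewrite (_ : C A = tsat Q (A := base A) X f) //; split=> [[B [Bfits Bf]]|Xf].
    suff -> : X = team_of (B tt) by exact: (Bf tt).
    apply/seteqP; split=> s.
      move=> Xs; have fs := Xk _ Xs; have /csat_CAnd[/csat_CImp H _] := Bfits s fs.
      split=> //; have [a [_ Sa]] := (XE s fs).1 Xs.
      by apply: H; exists a.
    move=> [fs Ts]; have /csat_CAnd[_ /csat_CImp H] := Bfits s fs.
    have [a Sa] := H Ts; apply/XE => //; exists a; split=> //.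
    exact: full_set.
  pose B (_ : unit) : set (k.-tuple A) := rel_of X (iota_tuple k 0).
  have BX : team_of (B tt) = X by apply: team_of_rel_of.
  exists B; split=> [s fs|[]]; last by rewrite BX.
  apply/csat_CAnd; split; apply/csat_CImp.
    move=> [a Sa]; have : X s.
      by apply/XE => //; exists a; split=> //; apply: full_set.
    by rewrite -BX => -[].
  move=> Ts; have : team_of (B tt) s by [].
  by rewrite BX => /(XE s fs)[a [_ Sa]]; exists a.
- move=> y; rewrite /= ?inE ?mem_cat ?inE !mem_iota !add0n /=.
  by case: eqVneq => [->|_]; rewrite ?xk //= ?orbb.
- by [].
Qed.

(** * Generalized atoms *)

(** The conditions of [rel_of_eqP] become formulas. The third gives one formula for each pair of
    positions with equal entries of [ys], a finite conjunction. *)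
Lemma rel_of_class (k : nat) (tau : vocab) (n : nat) (i : 'I_n -> nat)
    (j : 'I_n) (ys : (i j).-tuple var) :
  0 < k -> i j <= k -> (forall y, y \in tval ys -> y < k) ->
  sigma11k_class k (fun A : structure (sumvoc (teamvoc tau k) i) =>
    @rels _ A (inr j) = rel_of (cur_team (A := base A)) ys).
Proof.
move=> k0 ik ysk; pose S := @cur_atom tau k 'I_n i.
pose R zs := @new_atom (teamvoc tau k) 'I_n i j zs.
pose zs := [seq x <- iota 0 k | x \notin tval ys].
have zsk z : z \in zs -> z < k by rewrite mem_filter mem_iota => /andP[].
have Sk x : x \in cvars S -> x < k by rewrite mem_iota.
have H1 : sigma11k_class k (fun A => forall s : asg A, full k s ->
    csat s (CImp S (R ys))).
  apply: sigma11k_class_forall => x; rewrite /= mem_cat.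
  by case/orP => [/Sk|/ysk].
have H2 : sigma11k_class k (fun A => forall s : asg A, full k s ->
    csat s (CImp (R ys) (foldr (@CEx _) S zs))).
  apply: sigma11k_class_forall => x; rewrite /= cvars_CEx !mem_cat.
  by case/or3P => [/ysk|/zsk|/Sk].
have H3 (ab : 'I_(i j) * 'I_(i j)) : sigma11k_class k (fun A =>
    tnth ys ab.1 = tnth ys ab.2 -> forall s : asg A, full k s ->
    csat s (CImp (R (iota_tuple (i j) 0)) (@CEq _ (val ab.1) (val ab.2)))).
  have [yab|nyab] := eqVneq (tnth ys ab.1) (tnth ys ab.2); last first.
    apply: sigma11k_class_ext (sigma11k_class_true _ k0) => A.
    by split=> // _ yab; rewrite yab eqxx in nyab.
  (* Positions double as variables here; they stay below [k] because [i j <= k]. *)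
  pose g := CImp (R (iota_tuple (i j) 0)) (@CEq _ (val ab.1) (val ab.2)).
  apply: sigma11k_class_ext (@sigma11k_class_forall k _ g _).
    by move=> A; split=> [H _|/(_ yab)].
  move=> x; rewrite /= mem_cat mem_iota add0n !inE => /or3P[|/eqP->|/eqP->].
  - by move=> /= /leq_trans; apply.
  - by apply: leq_trans ik.
  - by apply: leq_trans ik.
apply: sigma11k_class_ext (sigma11k_class_and (sigma11k_class_and H1 H2)
  (sigma11k_class_all k0 H3)) => A.
have curk s : cur_team (A := base A) s -> full k s by case.
rewrite (rel_of_eqP _ (dom_inhabited A) curk ik ysk).
split=> [[[G1 G2] G3]|[G1 G2 G3]].
  split=> [s fs [_ Ss]|s fs Rs|a b yab s fs Rs].
  - by have /csat_CImp := G1 s fs; apply.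
  - have /csat_CImp /(_ Rs) /csat_CEx [s' ss' Ss'] := G2 s fs.
    by exists s' => //; split=> //; apply: full_reassigns ss'.
  - by have /csat_CImp := G3 (a, b) yab s fs; apply.
split; first split=> s fs; first 1 last.
- apply/csat_CImp => Rs; apply/csat_CEx.
  by have [s' ss' [_ Ss']] := G2 s fs Rs; exists s'.
- by move=> [a b] yab s fs; apply/csat_CImp; apply: G3.
- by apply/csat_CImp => Ss; apply: G1.
Qed.

(** With the guessed relations forced to be those of the team, the reduct along [h] is the structure
    on which the defining sentence is evaluated. *)
Lemma team_class_atom (k : nat) (tau : vocab) (n : nat) (i : 'I_n -> nat)
    (Q : gquant i) (ys : forall j : 'I_n, (i j).-tuple var) :
  0 < k -> sigma11k_definable k Q ->
  (forall j y, y \in tval (ys j) -> y < k) ->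
  sigma11k_class k (team_class (tau := tau) (k := k) Q (TAtom ys)).
Proof.
move=> k0 [ik [p pk pP]] ysk.
pose h (j : sym (typevoc i)) : sym (sumvoc (teamvoc tau k) i) := inr j.
pose e j : ar j = ar (h j) := erefl.
have H1 := sigma11k_class_all k0
  (fun j => rel_of_class tau k0 (ik j) (@ysk j)).
have H2 := sigma11k_class_reduct e (sigma11k_class_sigma11 pk).
apply: sigma11k_class_ext (sigma11k_class_ex (sigma11k_class_and H1 H2)) => A.
pose X := cur_team (A := A).
(* Definability of the atom concerns teams with a common domain; full assignments share x_1, ...,
   x_k. *)
have Xteam : team (seq_fset tt (iota 0 k)) X by move=> s [/domf_full].
have ysX j x : x \in tval (ys j) -> x \in seq_fset tt (iota 0 k).
  by move=> /ysk xk; rewrite seq_fsetE mem_iota.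
rewrite /team_class (pP tau (base A) _ _ _ Xteam ysX).
split=> [[B [BE Bp]]|Xp].
  have {}BE : B = (fun j => rel_of X (ys j)).
    by apply: functional_extensionality_dep => j; apply: BE.
  by move: Bp; rewrite BE.
by exists (fun j => rel_of X (ys j)); split.
Qed.

(** * Induction on formulas and passage to sentences *)

Lemma team_classP (k : nat) (tau : vocab) (n : nat) (i : 'I_n -> nat)
    (Q : gquant i) (phi : tform tau i) :
  0 < k -> sigma11k_definable k Q -> (forall x, x \in tvars phi -> x < k) ->
  sigma11k_class k (team_class (k := k) Q phi).
Proof.
move=> k0 hQ.
elim: phi => [R ys|R ys|x y|x y|ys|f IHf g IHg|f IHf g IHg|x f IHf|x f IHf] /= vk.
- exact: (@literal_class k tau (CRel R ys) vk).
(* A negated literal demands defined values while [CNot] does not; on full assignments the two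
   agree. *)
- apply: sigma11k_class_ext (@literal_class k tau (CNot (CRel R ys)) vk) => A.
  split=> H s Cs; have [fs _] := Cs.
    have [t st] := full_vals fs vk; exists t => // Rt.
    by apply: (H s Cs); exists t.
  have [t st nRt] := H s Cs => -[t' st' Rt'].
  by apply: nRt; rewrite (vals_unique st st').
- exact: (@literal_class k tau (CEq x y) vk).
- apply: sigma11k_class_ext (@literal_class k tau (CNot (CEq x y)) vk) => A.
  split=> H s Cs; have [fs _] := Cs.
    have [a sa] := @full_fnd _ _ _ x fs (vk x (mem_head _ _)).
    have [|b sb] := @full_fnd _ _ _ y fs (vk y _); first by rewrite !inE eqxx orbT.
    by exists a, b; split=> // ab; apply: (H s Cs); exists a, b.
  have [a [b [sa sb nab]]] := H s Cs => -[a' [b' [sa' sb' ab']]].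
  by apply: nab; move: sa' sb'; rewrite sa sb => -[->] [->].
- apply: team_class_atom => // j y yj; apply: vk; apply/flattenP.
  by exists (tval (ys j)) => //; apply/mapP; exists j; rewrite ?mem_enum.
- apply: team_class_and; [apply: IHf|apply: IHg] => x xv; apply: vk;
    by rewrite mem_cat xv ?orbT.
- apply: team_class_or => //; [apply: IHf|apply: IHg] => x xv; apply: vk;
    by rewrite mem_cat xv ?orbT.
- apply: team_class_ex => //; first by apply: vk; rewrite mem_head.
  by apply: IHf => y yv; apply: vk; rewrite inE yv orbT.
- apply: team_class_all => //; first by apply: vk; rewrite mem_head.
  by apply: IHf => y yv; apply: vk; rewrite inE yv orbT.
Qed.

Theorem theorem6 (k : nat) (hk : 1 <= k) (n : nat) (i : 'I_n -> nat)
    (Q : gquant i) (hQ : sigma11k_definable k Q)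
    (tau : vocab) (phi : tform tau i) (hphi : FOk_sentence k phi) :
  exists2 psi : sigma11 tau, sigma11k_sentence k psi &
    forall A : structure tau, ttrue Q A phi <-> sigma11_true A psi.
Proof.
have [phi0 phik] := hphi; apply: sigma11_of_class.
pose S := @CRel (teamvoc tau k) (inr tt) (iota_tuple k 0).
have Sk x : x \in cvars S -> x < k by rewrite mem_iota.
(* The initial team is guessed as well; [S] forces it to contain all full assignments. *)
apply: sigma11k_class_ext (sigma11k_class_ex (sigma11k_class_and
  (sigma11k_class_forall Sk) (team_classP hk hQ phik))) => A.
(* Without free variables, any two nonempty teams agree. *)
have local (X Y : set (asg A)) : X !=set0 -> Y !=set0 -> tsat Q X phi -> tsat Q Y phi.
  move=> [s Xs] [s' Ys']; apply: team_locality; rewrite phi0.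
  by split=> u _; [exists s'|exists s].
have [a] := dom_inhabited A.
(* The domain is inhabited, so the full team is nonempty. *)
pose s := asg_of (fun=> a) (iota 0 k).
have fs : full k s by apply: full_asg_of.
rewrite /ttrue; case: A a local s fs => D iD rD a local s fs.
split=> [[B [BS Bphi]]|phi1].
  apply: (local (team_of (B tt))) Bphi; last by exists [fmap].
  by exists s; split=> //; apply: (BS s fs).
have full_val u : full k u -> exists2 t : k.-tuple D, vals u (iota_tuple k 0) t & setT t.
  by move=> fu; have [|t ut] := @full_vals k D u k (iota_tuple k 0) fu;
    [move=> y; rewrite mem_iota | exists t].
exists (fun=> setT); split=> [u /full_val //|].
apply: local phi1; first by exists [fmap].
by exists s; split=> //; apply: full_val.
Qed.
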